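(* Let $k>2$ be an even integer that is not of the form $2^t$ for any integer $t\ge 2$. Then the line graph $L(B(2k+1,k))$ is a vertex-transitive non-Cayley graph.
   Context: For integers $n\ge 4$ and $1\le k<\frac n2$, let $[n]=\{1,\dots,n\}$. The graph $B(n,k)$ has vertex set $V=\{v\subset[n] : |v|\in\{k,k+1\}\}$, and two vertices $v,w$ are adjacent iff $v\subset w$ or $w\subset v$ (for $n=2k+1$ this is the middle layer graph of the hypercube $Q_{2k+1}$). The line graph $L(\Gamma)$ has the edges of $\Gamma$ as vertices, two being adjacent iff the edges share an endpoint. A graph is a Cayley graph if it is isomorphic to some $\mathrm{Cay}(G;\Omega)$ (vertex set a group $G$, $\Omega=\Omega^{-1}\not\ni 1$, $g\sim h$ iff $g^{-1}h\in\Omega$). *)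

(* Defs.v *)
From HB Require Import structures.
From mathcomp Require Import all_boot all_fingroup.
Set Implicit Arguments. Unset Strict Implicit. Unset Printing Implicit Defensive.

Definition Bvert (n k : nat) := {v : {set 'I_n} | (#|v| == k) || (#|v| == k.+1)}.

Definition Badj (n k : nat) : rel (Bvert n k) :=
  fun v w => (val v \proper val w) || (val w \proper val v).

Definition edge_set (T : finType) (e : rel T) : {set {set T}} :=
  [set E | [exists u, exists w, e u w && (E == [set u; w])]].

Definition line_vert (T : finType) (e : rel T) := {E : {set T} | E \in edge_set e}.

Definition line_adj (T : finType) (e : rel T) : rel (line_vert e) :=
  fun E F => (val E != val F) && (val E :&: val F != set0).

Definition is_automorphism (V : finType) (e : rel V) (f : V -> V) : Prop :=
  bijective f /\ forall u v, e (f u) (f v) = e u v.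

Definition vertex_transitive (V : finType) (e : rel V) : Prop :=
  forall x y : V, exists f : V -> V, is_automorphism e f /\ f x = y.

(* Cayley graph: isomorphic to Cay(G; Om) with Om = Om^-1, 1 \notin Om,
   g ~ h iff g^-1 h \in Om.  (A finite graph can only be isomorphic to a
   Cayley graph of a finite group.) *)
Definition is_cayley (V : finType) (e : rel V) : Prop :=
  exists (gT : finGroupType) (Om : {set gT}),
    [/\ (1 \notin Om)%g,
        (forall x : gT, x \in Om -> (x^-1)%g \in Om) &
        exists f : V -> gT, bijective f /\
          forall u v, e u v = (((f u)^-1 * f v)%g \in Om)].

(* Main.v *)
Require Import Defs.
From HB Require Import structures.
From mathcomp Require Import all_boot all_fingroup.
From mathcomp Require Import all_solvable zify.

Set Implicit Arguments. Unset Strict Implicit. Unset Printing Implicit Defensive.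

(* An edge v < w of B(2k+1,k) is a flag: a k-set inside a (k+1)-set, and two edges
   are adjacent in the line graph iff the flags share exactly one member.  Permutations
   of the points are transitive on flags.
   Suppose a group G acts regularly on the flags by automorphisms of the line graph.
   The cliques of flags with a common member are recovered from triangles, so by
   connectivity each element of G either keeps or exchanges the two types of cliques;
   those keeping them form a subgroup R of index at most 2.  Now
   #|G| = (2k+1)! / (k!)^2 has 2-adic valuation k - v_2(k!), which is at least 2 unless
   k is a power of 2, so R contains an involution.  It acts on the k-sets and on the
   (k+1)-sets compatibly with inclusion; descending level by level to the singletons
   shows that it is induced by an involution s of the 2k+1 points.  Since k is even, s
   stabilises a k-set and fixes a point outside it, hence fixes a flag, contradicting
   regularity. *)

(** * The 2-adic valuation of factorials *)

Lemma logn2_fact_double (m : nat) : logn 2 (m.*2)`! = m + logn 2 m`!.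
Proof.
elim: m => [//|m IHm]; rewrite doubleS !factS !lognM ?muln_gt0 ?fact_gt0 //.
rewrite -doubleS -mul2n lognM // IHm (lognE 2 m.*2.+1) dvdn2 /= odd_double /=.
have -> : logn 2 2 = 1 by []; lia.
Qed.

Lemma logn2_fact_lt (k : nat) : 0 < k -> logn 2 k`! < k.
Proof.
elim/ltn_ind: k => k IHk k_gt0.
have [->|k_neq1] := eqVneq k 1; first by [].
have half_gt0 : 0 < k./2 by lia.
have /IHk /(_ half_gt0) lt_half : k./2 < k by lia.
rewrite -(odd_double_half k); case: (odd k) => /=; last first.
  by rewrite add0n logn2_fact_double; lia.
rewrite add1n factS lognM ?fact_gt0 // logn2_fact_double lognE dvdn2 /= odd_double /=.
lia.
Qed.

(** By Legendre's formula, v_2(k!) is k minus the number of binary ones of k, and that number is 1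
    only for powers of 2. The induction strips the last digit: a final 0 passes the hypothesis on to
    [k./2], while a final 1 needs only [logn2_fact_lt]. *)
Lemma logn2_fact_le (k : nat) :
  0 < k -> (forall t, k != 2 ^ t) -> (logn 2 k`!).+1 < k.
Proof.
elim/ltn_ind: k => k IHk k_gt0 kNpow.
have k_neq1 : k != 1 by exact: (kNpow 0).
have half_gt0 : 0 < k./2 by lia.
have half_lt : k./2 < k by lia.
have := odd_double_half k; move: k./2 half_gt0 half_lt => m half_gt0 half_lt.
case: (odd k) => /= def_k.
  have := logn2_fact_lt half_gt0.
  rewrite -def_k add1n factS lognM ?fact_gt0 // logn2_fact_double (lognE 2 m.*2.+1) dvdn2 /=.
  by rewrite odd_double /=; lia.
have halfNpow t : m != 2 ^ t.
  by apply: contraNneq (kNpow t.+1) => half_pow; rewrite expnS -half_pow; lia.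
have := IHk _ half_lt half_gt0 halfNpow.
by rewrite -def_k add0n logn2_fact_double; lia.
Qed.

(** * Inclusion-preserving maps between two levels of the subset lattice *)

Section Levels.
Variable T : finType.
Implicit Types (u v w A B S : {set T}) (f g : {set T} -> {set T}).

Lemma subset_of_card A m : m <= #|A| -> exists2 B : {set T}, B \subset A & #|B| = m.
Proof.
elim: m => [|m IHm] lt_m; first by exists set0; rewrite ?sub0set ?cards0.
have [B sBA cardB] := IHm (ltnW lt_m).
have /set0Pn[x /setDP[Ax BNx]] : A :\: B != set0.
  by rewrite -card_gt0 cardsD (setIidPr sBA) cardB subn_gt0.
exists (x |: B); last by rewrite cardsU1 BNx cardB.
by rewrite subUset sub1set Ax.
Qed.

(** The set grows by two points of [S] at a time: a 2-cycle of [s] outside [A] if there is one, and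
    two fixed points otherwise. *)
Lemma involution_stable_subset (s : T -> T) S m :
    involutive s -> (forall x, x \in S -> s x \in S) -> m.*2 <= #|S| ->
  exists A : {set T}, [/\ A \subset S, #|A| = m.*2 & forall x, x \in A -> s x \in A].
Proof.
move=> sK stS; elim: m => [|m IHm] le_m.
  by exists set0; rewrite sub0set cards0; split=> // x; rewrite inE.
have [|A [sAS cardA stA]] := IHm; first by lia.
have stD x : x \in S :\: A -> s x \in S :\: A.
  rewrite !inE => /andP[ANx Sx]; rewrite stS // andbT.
  by apply: contra ANx => /stA; rewrite sK.
have cardD : 1 < #|S :\: A| by rewrite cardsD (setIidPr sAS); lia.
have extend x y : x \in S :\: A -> y \in S :\: A -> x != y ->
    (s x \in [set x; y]) -> (s y \in [set x; y]) ->
  exists A : {set T}, [/\ A \subset S, #|A| = m.+1.*2 & forall x, x \in A -> s x \in A].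
  move=> /setDP[Sx ANx] /setDP[Sy ANy] xNy sx sy; exists (A :|: [set x; y]); split.
  - by rewrite !subUset sAS !sub1set Sx.
  - rewrite cardsU cards2 xNy cardA (_ : A :&: _ = set0) ?cards0 ?subn0 //; first by lia.
    apply/setP=> z; rewrite !inE; apply/andP=> -[Az /orP[]/eqP zE].
      by rewrite -zE Az in ANx.
    by rewrite -zE Az in ANy.
  - by move=> z; rewrite in_setU => /orP[/stA sz|/set2P[]->]; rewrite in_setU ?sz ?sx ?sy ?orbT.
have [/existsP[x /andP[Dx sxNx]]|] := boolP [exists x, (x \in S :\: A) && (s x != x)].
  by apply: (extend x (s x)); rewrite ?stD // ?sK ?inE ?eqxx ?orbT // eq_sym.
rewrite negb_exists => /forallP fixD.
have {}fixD x : x \in S :\: A -> s x = x.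
  by move=> Dx; apply/eqP; have := fixD x; rewrite Dx /= negbK.
have /card_gt1P[x [y [Dx Dy xNy]]] := cardD.
by apply: (extend x y) => //; rewrite fixD // !inE eqxx ?orbT.
Qed.

(** As [w] has at least two points, each [y] in [w] lies in some j-set [w :\ z], whose image under
    [s] is contained in [g w]. Cardinality gives equality. *)
Lemma level_ascend (s : {perm T}) j f g :
    0 < j -> (forall v, #|v| = j -> f v = s @: v) ->
    (forall w, #|w| = j.+1 -> #|g w| = j.+1) ->
    (forall v w, #|v| = j -> #|w| = j.+1 -> v \subset w -> f v \subset g w) ->
  forall w, #|w| = j.+1 -> g w = s @: w.
Proof.
move=> j_gt0 fE gcard fg w cardw; apply/eqP; rewrite eq_sym eqEcard.
rewrite (card_imset _ perm_inj) gcard // cardw leqnn andbT.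
apply/subsetP=> _ /imsetP[y wy ->].
have /card_gt0P[z] : 0 < #|w :\ y| by have := cardsD1 y w; rewrite wy; lia.
rewrite !inE => /andP[zNy wz].
have cardv : #|w :\ z| = j by have := cardsD1 z w; rewrite wz; lia.
have /subsetP := fg _ _ cardv cardw (subD1set w z); apply; rewrite fE //.
by apply: imset_f; rewrite !inE eq_sym zNy.
Qed.

Definition upper_covers u := [set x |: u | x in ~: u].

Lemma card_upper_covers u : #|upper_covers u| = #|T| - #|u|.
Proof.
rewrite card_in_imset => [|x y]; first by rewrite cardsCs setCK.
rewrite !inE => uNx uNy /setP/(_ x).
by rewrite !inE eqxx (negbTE uNx) !orbF => /esym/eqP.
Qed.

Lemma upper_coversE u v :
  (v \in upper_covers u) = (u \subset v) && (#|v| == #|u|.+1).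
Proof.
apply/imsetP/andP => [[x]|[suv /eqP cardv]].
  by rewrite inE => uNx ->; rewrite subsetUr cardsU1 uNx.
have /cards1P[x Dx] : #|v :\: u| == 1 by rewrite cardsD (setIidPr suv); lia.
have : x \in v :\: u by rewrite Dx inE.
rewrite !inE => /andP[uNx vx]; exists x; rewrite ?inE //.
apply/eqP; rewrite eq_sym eqEcard subUset sub1set vx suv cardsU1 uNx cardv.
by rewrite add1n leqnn.
Qed.

(** A point [y] of [u'] outside [u] would lie in every upper cover of [u], but the cover [x |: u]
    with [x != y] misses it; the bound on [#|u|] provides [x]. *)
Lemma upper_covers_inj u u' : #|u|.+1 < #|T| ->
  #|u| = #|u'| -> upper_covers u = upper_covers u' -> u = u'.
Proof.
move=> u_small eq_card eq_up; apply/eqP; rewrite eq_sym eqEcard eq_card leqnn andbT.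
apply/subsetP=> y u'y; apply: contraT => uNy.
have /card_gt0P[x] : 0 < #|~: (y |: u)|.
  by have := cardsC (y |: u); rewrite cardsU1 uNy; lia.
rewrite !inE negb_or => /andP[xNy uNx].
have : x |: u \in upper_covers u' by rewrite -eq_up; apply: imset_f; rewrite inE.
rewrite upper_coversE => /andP[/subsetP/(_ y u'y)].
by rewrite !inE (negbTE uNy) orbF eq_sym (negbTE xNy).
Qed.

(* The images of the upper covers of u are sets b_x whose pairwise unions lie in
   distinct (j+2)-sets, so b_x, b_y, b_z are the pairwise intersections of three
   such sets; hence all pairwise intersections of the b_x agree. *)
Lemma level_perm j f g :
    0 < j -> j.+1 < #|T| ->
    (forall v, #|v| = j -> #|f v| = j) ->
    (forall v v', #|v| = j -> #|v'| = j -> f v = f v' -> v = v') ->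
    (forall w, #|w| = j.+1 -> #|g w| = j.+1) ->
    (forall w w', #|w| = j.+1 -> #|w'| = j.+1 -> g w = g w' -> w = w') ->
    (forall v w, #|v| = j -> #|w| = j.+1 -> v \subset w -> f v \subset g w) ->
  exists s : {perm T}, forall v, #|v| = j -> f v = s @: v.
Proof.
elim: j f g => [//|[|j] IHj] f g _ j_small fcard finj gcard ginj fg.
  have s1 x : {y | f [set x] = [set y]}.
    apply/sig_eqW; have /eqP/cards1P[y ->] : #|f [set x]| = 1 by rewrite fcard ?cards1.
    by exists y.
  have s_inj : injective (fun x => sval (s1 x)).
    move=> x y eq_s; apply: set1_inj; apply: finj; rewrite ?cards1 //.
    by rewrite (svalP (s1 x)) (svalP (s1 y)) eq_s.
  exists (perm s_inj) => v /eqP/cards1P[x ->].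
  by rewrite imset_set1 permE; apply: (svalP (s1 x)).
have cardU1 u x : x \notin u -> #|x |: u| = #|u|.+1 by rewrite cardsU1 => ->.
have cardU2 u x y : x \notin u -> y \notin u -> x != y -> #|[set x; y] :|: u| = #|u|.+2.
  by move=> uNx uNy xNy; rewrite -setUA !cardsU1 !inE negb_or xNy uNx uNy.
have U1_neq u x y : x \notin u -> x != y -> x |: u != y |: u.
  move=> uNx xNy; apply/eqP=> /setP/(_ x).
  by rewrite !inE eqxx (negbTE uNx) (negbTE xNy).
have f_meet u x y z : #|u| = j.+1 -> x \notin u -> y \notin u -> z \notin u ->
    x != y -> x != z -> y != z -> f (x |: u) :&: f (y |: u) = f (x |: u) :&: f (z |: u).
  move=> cardu uNx uNy uNz xNy xNz yNz.
  (* The left side has j+2 points and lies in two sets of j+3 points, distinct by injectivity of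
     [g]; so it fills their intersection. *)
  have fE a b c : a \notin u -> b \notin u -> c \notin u -> a != b -> a != c -> b != c ->
      f (a |: u) = g ([set a; b] :|: u) :&: g ([set a; c] :|: u).
    move=> uNa uNb uNc aNb aNc bNc; apply/eqP; rewrite eqEcard subsetI.
    rewrite !fg ?cardU1 ?cardU2 ?cardu //=; try by rewrite setSU // sub1set !inE eqxx.
    rewrite fcard ?cardU1 ?cardu // -ltnS.
    rewrite ltnNge; apply/negP=> le_card.
    have sub a' b' : a' \notin u -> b' \notin u -> a' != b' ->
      #|g ([set a'; b'] :|: u)| = j.+3 by move=> *; rewrite gcard ?cardU2 ?cardu.
    have eq1 : g ([set a; b] :|: u) :&: g ([set a; c] :|: u) = g ([set a; b] :|: u).
      by apply/eqP; rewrite eqEcard subsetIl sub.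
    have eq2 : g ([set a; b] :|: u) :&: g ([set a; c] :|: u) = g ([set a; c] :|: u).
      by apply/eqP; rewrite eqEcard subsetIr sub.
    have /ginj : g ([set a; b] :|: u) = g ([set a; c] :|: u) by rewrite -eq1 eq2.
    rewrite !cardU2 ?cardu // => /(_ erefl erefl)/setP/(_ b).
    by rewrite !inE eqxx (negbTE uNb) (negbTE bNc) eq_sym (negbTE aNb).
  rewrite (fE x y z) // (fE y x z) // 1?eq_sym // (fE z x y) // 1?eq_sym //.
  rewrite (setUC [set y] [set x]) (setUC [set z] [set x]) (setUC [set z] [set y]).
  by apply/setP=> a; rewrite !inE; do 3!case: (_ \in g _).
have f_meet_card u x y : #|u| = j.+1 -> x \notin u -> y \notin u -> x != y ->
    #|f (x |: u) :&: f (y |: u)| = j.+1.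
  move=> cardu uNx uNy xNy.
  have cardx : #|f (x |: u)| = j.+2 by rewrite fcard ?cardU1 ?cardu.
  have cardy : #|f (y |: u)| = j.+2 by rewrite fcard ?cardU1 ?cardu.
  have := cardsUI (f (x |: u)) (f (y |: u)); rewrite cardx cardy.
  have : #|f (x |: u) :|: f (y |: u)| <= j.+3.
    rewrite -(gcard ([set x; y] :|: u)) ?cardU2 ?cardu // subset_leq_card //.
    by rewrite subUset !fg ?cardU1 ?cardU2 ?cardu // setSU // sub1set !inE eqxx ?orbT.
  suff : #|f (x |: u) :&: f (y |: u)| < j.+2 by lia.
  rewrite -cardx proper_card // properEneq subsetIl andbT.
  apply: contraNneq (U1_neq u x y uNx xNy) => /setIidPl sxy.
  apply/eqP/finj; rewrite ?cardU1 ?cardu //.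
  by apply/eqP; rewrite eqEcard sxy cardx cardy leqnn.
(* [h] is the induced map one level down; by [f_meet], any two upper covers of [u] already determine
   [h u]. *)
pose h u := \bigcap_(x in ~: u) f (x |: u).
have hE u x y : #|u| = j.+1 -> x \notin u -> y \notin u -> x != y ->
    h u = f (x |: u) :&: f (y |: u).
  move=> cardu uNx uNy xNy; apply/eqP; rewrite eqEsubset subsetI !bigcap_inf ?inE //=.
  apply/bigcapsP=> z; rewrite inE => uNz.
  have [->|zNx] := eqVneq z x; first exact: subsetIl.
  have [->|zNy] := eqVneq z y; first exact: subsetIr.
  by rewrite (f_meet u x y z) // 1?eq_sym // subsetIr.
have hcard u : #|u| = j.+1 -> #|h u| = j.+1.
  move=> cardu; have /card_gt1P[x [y [uNx uNy xNy]]] : 1 < #|~: u|.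
    by have := cardsC u; lia.
  by rewrite !inE in uNx uNy; rewrite (hE u x y) ?f_meet_card.
have hf u v : #|u| = j.+1 -> #|v| = j.+2 -> u \subset v -> h u \subset f v.
  move=> cardu cardv suv.
  have : v \in upper_covers u by rewrite upper_coversE suv cardv cardu eqxx.
  by case/imsetP=> x uNx ->; rewrite /h; apply: bigcap_inf.
(* Since [f] is injective, [h u] thus determines the upper covers of [u], hence [u] itself. *)
have f_up u : #|u| = j.+1 -> f @: upper_covers u = upper_covers (h u).
  move=> cardu; apply/eqP; rewrite eqEcard; apply/andP; split.
    apply/subsetP=> a /imsetP[v]; rewrite !upper_coversE cardu => /andP[suv /eqP cardv] ->.
    by rewrite hf // hcard // fcard // eqxx.
  rewrite card_in_imset => [|v v']; first by rewrite !card_upper_covers hcard cardu.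
  rewrite !upper_coversE cardu => /andP[_ /eqP cardv] /andP[_ /eqP cardv'].
  exact: finj.
have hinj u u' : #|u| = j.+1 -> #|u'| = j.+1 -> h u = h u' -> u = u'.
  move=> cardu cardu' eq_h; apply: upper_covers_inj; rewrite ?cardu ?cardu' //; first by lia.
  have sub (a b v : {set T}) : #|a| = j.+1 -> #|b| = j.+1 -> h a = h b ->
      v \in upper_covers a -> v \in upper_covers b.
    move=> carda cardb eq_ab av.
    have : f v \in f @: upper_covers b by rewrite f_up // -eq_ab -f_up // imset_f.
    case/imsetP=> v' bv' eq_f; have -> // : v = v'.
    by apply: finj eq_f; apply/eqP; move: av bv';
       rewrite !upper_coversE carda cardb => /andP[_ cardv] /andP[_ cardv'].
  by apply/setP=> v; apply/idP/idP; apply: sub.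
(* The induction hypothesis applies to the pair of [h] and [f]; the permutation found for [h] is
   then carried up to [f]. *)
have [||s hs] := IHj h f _ _ hcard hinj fcard finj hf; [by []|by lia|].
by exists s; apply: level_ascend hs fcard hf.
Qed.

End Levels.

(** * Automorphisms of the graph of flags *)

Section Coordinates.
Variables (V : finType) (C : eqType) (e : rel V).

(** The labels stand for the two ends of an edge. The notion is symmetric in them, so automorphisms
    that exchange the two types of cliques are treated by swapping the labels. *)
Definition line_coords (l1 l2 : V -> C) :=
  (forall E F, e E F = (E != F) && ((l1 E == l1 F) || (l2 E == l2 F))) /\
  (forall E F, l1 E = l1 F -> l2 E = l2 F -> E = F).

Lemma line_coordsC l1 l2 : line_coords l1 l2 -> line_coords l2 l1.
Proof. by case=> adj inj; split=> E F; [rewrite adj orbC|move=> *; apply: inj]. Qed.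

(** If [G] shared only the second label with [E] or with [F], then the first label with neither, so
    [E] and [F] would agree in both labels. *)
Lemma line_triangle l1 l2 E F G : line_coords l1 l2 ->
  E != F -> l1 E = l1 F -> e E G -> e F G -> l1 G = l1 E.
Proof.
move=> [adj inj] EneqF eq1; rewrite !adj => /andP[_ /orP[/eqP-> //|/eqP EG]].
case/andP=> _ /orP[/eqP<- //|/eqP FG].
by case/eqP: EneqF; apply: inj; rewrite ?EG.
Qed.

Definition respects (l m : V -> C) (phi : V -> V) :=
  forall E F, l E = l F -> m (phi E) = m (phi F).

(** The version of [respects] local to one flag, which can be propagated along paths of flags. *)
Definition respects_at (l m : V -> C) (phi : V -> V) E :=
  forall G, l G = l E -> m (phi G) = m (phi E).

Variable phi : V -> V.
Hypotheses (phi_inj : injective phi) (phi_e : forall E F, e (phi E) (phi F) = e E F).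

(* A flag sharing only its other member with E is not adjacent to F, so its image
   cannot join the clique spanned by phi E and phi F. *)
Lemma respects_at_of_pair l1 l2 m1 m2 E F :
    line_coords l1 l2 -> line_coords m1 m2 ->
    E != F -> l1 E = l1 F -> m1 (phi E) = m1 (phi F) ->
  respects_at l1 m1 phi E /\ respects_at l2 m2 phi E.
Proof.
move=> cl cm EneqF eql eqm; have [adjl injl] := cl; have [adjm injm] := cm.
have phi_neq G H : G != H -> phi G != phi H by rewrite (inj_eq phi_inj).
split=> G GE; have [->//|GneqE] := eqVneq G E.
  have [->//|GneqF] := eqVneq G F.
  apply: (line_triangle cm (phi_neq _ _ EneqF) eqm); rewrite phi_e adjl eq_sym.
    by rewrite GneqE GE eqxx.
  by rewrite GneqF GE eql eqxx.
have eEG : e E G by rewrite adjl eq_sym GneqE GE eqxx orbT.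
have : e (phi E) (phi G) by rewrite phi_e.
rewrite adjm => /andP[_ /orP[/eqP m1EG|/eqP-> //]].
have GneqF : G != F.
  by apply: contraNneq EneqF => GF; apply/eqP/injl; rewrite // -GE GF.
have eFG : e F G by rewrite -phi_e adjm -eqm m1EG eqxx phi_neq // eq_sym.
have := line_triangle cl EneqF eql eEG eFG.
by move/injl/(_ GE)/eqP; rewrite (negbTE GneqE).
Qed.

End Coordinates.

Section Flags.
Variables (T V : finType) (e : rel V) (lo hi : V -> {set T}) (k : nat).
Hypotheses (k_gt0 : 0 < k) (k_small : k.+2 <= #|T|).
Hypothesis lo_card : forall E, #|lo E| = k.
Hypothesis hi_card : forall E, #|hi E| = k.+1.
Hypothesis lo_hi : forall E, lo E \subset hi E.
Hypothesis flag : forall v w : {set T},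
  #|v| = k -> #|w| = k.+1 -> v \subset w -> exists2 E, lo E = v & hi E = w.
Hypothesis coords : line_coords e lo hi.

Lemma flag_lo E x : x \notin lo E -> exists2 F, lo F = lo E & hi F = x |: lo E.
Proof.
by move=> xNE; apply: flag; rewrite ?cardsU1 ?lo_card ?xNE ?subsetUr.
Qed.

Lemma flag_hi E x : x \in hi E -> exists2 F, lo F = hi E :\ x & hi F = hi E.
Proof.
move=> xE; apply: flag; rewrite ?hi_card ?subD1set //.
by have := cardsD1 x (hi E); rewrite hi_card xE; lia.
Qed.

(** Adding a point [x] of [lo F] to [lo E] and then deleting a point [y] outside [lo F] takes two
    moves and shrinks [lo E :\: lo F]. *)
Lemma flag_connected (P : V -> Prop) E0 : P E0 ->
    (forall E F, P E -> lo F = lo E \/ hi F = hi E -> P F) ->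
  forall E, P E.
Proof.
move=> PE0 step F.
have [m] := ubnP #|lo E0 :\: lo F|; elim: m E0 PE0 => // m IHm E PE lt_m.
have [loE|loE] := eqVneq (lo E) (lo F); first by apply: step PE _; left.
have /subsetPn[y yE yNF] : ~~ (lo E \subset lo F).
  by apply: contra loE => sEF; rewrite eqEcard sEF !lo_card leqnn.
have /subsetPn[x xF xNE] : ~~ (lo F \subset lo E).
  by apply: contra loE => sFE; rewrite eq_sym eqEcard sFE !lo_card leqnn.
have [E1 lo1 hi1] := flag_lo xNE.
have y1 : y \in hi E1 by rewrite hi1 !inE yE orbT.
have [E2 lo2 hi2] := flag_hi y1.
have PE1 : P E1 by apply: step PE _; left.
have PE2 : P E2 by apply: step PE1 _; right.
apply: IHm PE2 _.
have : lo E2 :\: lo F \subset (lo E :\: lo F) :\ y.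
  apply/subsetP=> z; rewrite lo2 hi1 !inE => /and3P[zNF zNy /predU1P[zx|zE]].
    by rewrite zx xF in zNF.
  by rewrite zNF zNy zE.
move/subset_leq_card; have := cardsD1 y (lo E :\: lo F).
by rewrite !inE yE yNF; lia.
Qed.

Lemma other_flag_lo E : exists2 F, E != F & lo E = lo F.
Proof.
have /card_gt0P[x] : 0 < #|~: hi E| by have := cardsC (hi E); rewrite hi_card; lia.
rewrite inE => xNhi; have xNlo : x \notin lo E.
  by apply: contra xNhi; apply/subsetP/lo_hi.
have [F loF hiF] := flag_lo xNlo; exists F => //.
by apply: contraNneq xNhi => ->; rewrite hiF !inE eqxx.
Qed.

Lemma respects_flags phi :
    injective phi -> (forall E F, e (phi E) (phi F) = e E F) ->
    (respects lo lo phi /\ respects hi hi phi) \/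
    (respects lo hi phi /\ respects hi lo phi).
Proof.
move=> phi_inj phi_e.
have coords' := line_coordsC coords.
have spread m1 m2 E0 : line_coords e m1 m2 ->
    respects_at lo m1 phi E0 /\ respects_at hi m2 phi E0 ->
  respects lo m1 phi /\ respects hi m2 phi.
  move=> cm at0; suff at_all E : respects_at lo m1 phi E /\ respects_at hi m2 phi E.
    by split=> E F EF; case: (at_all F); [move/(_ E EF)|move=> _ /(_ E EF)].
  pose P G := respects_at lo m1 phi G /\ respects_at hi m2 phi G.
  apply: (@flag_connected P E0 at0) => {}E F [at1 at2] EF.
  have [->|EneqF] := eqVneq F E; first by [].
  case: EF => [loF|hiF].
    exact: (respects_at_of_pair phi_inj phi_e coords cm EneqF loF (at1 F loF)).
  have cm' := line_coordsC cm.
  by have [] := respects_at_of_pair phi_inj phi_e coords' cm' EneqF hiF (at2 F hiF).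
have [/existsP[E0 _]|/existsPn noE] := boolP [exists E : V, true]; last first.
  by left; split=> E; have := noE E.
(* The images of one pair with a common [lo] share a [lo] or a [hi]; this choice then spreads to all
   flags. *)
have [F E0neqF loF] := other_flag_lo E0.
have : e (phi E0) (phi F) by rewrite phi_e coords.1 E0neqF loF eqxx.
rewrite coords.1 => /andP[_ /orP[]/eqP eqF]; [left|right].
  exact: spread (respects_at_of_pair phi_inj phi_e coords coords E0neqF loF eqF).
exact: spread (respects_at_of_pair phi_inj phi_e coords coords' E0neqF loF eqF).
Qed.

Lemma respects_flags_perm (phi : V -> V) :
    respects lo lo phi -> respects hi hi phi -> involutive phi ->
  exists s : {perm T},
    involutive s /\ forall E, lo (phi E) = s @: lo E /\ hi (phi E) = s @: hi E.
Proof.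
move=> phi_lo phi_hi phiK.
(* The default value is never reached where it matters: by [loP] and [hiP], every k-set is some
   [lo E] and every (k+1)-set some [hi E]. *)
pose push (l : V -> {set T}) (v : {set T}) := if [pick E | l E == v] is Some E then l (phi E) else v.
have pushE l E : respects l l phi -> push l (l E) = l (phi E).
  by rewrite /push => phi_l; case: pickP => [F /eqP/phi_l //|/(_ E)]; rewrite eqxx.
have push_lo E : push lo (lo E) = lo (phi E) by exact: pushE.
have push_hi E : push hi (hi E) = hi (phi E) by exact: pushE.
have loP (v : {set T}) : #|v| = k -> exists E, lo E = v.
  move=> cardv; have /card_gt0P[x] : 0 < #|~: v| by have := cardsC v; lia.
  rewrite inE => xNv; have [||E loE _] := flag cardv (_ : #|x |: v| = k.+1).
  - by rewrite cardsU1 xNv cardv.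
  - exact: subsetUr.
  - by exists E.
have hiP (w : {set T}) : #|w| = k.+1 -> exists E, hi E = w.
  move=> cardw; have /card_gt0P[x xw] : 0 < #|w| by rewrite cardw.
  have [||E _ hiE] := flag (_ : #|w :\ x| = k) cardw.
  - by have := cardsD1 x w; rewrite xw cardw; lia.
  - exact: subD1set.
  - by exists E.
have lo_inj (v v' : {set T}) : #|v| = k -> #|v'| = k -> push lo v = push lo v' -> v = v'.
  move=> /loP[E <-] /loP[F <-]; rewrite !push_lo => /phi_lo.
  by rewrite !phiK.
have hi_inj (v v' : {set T}) : #|v| = k.+1 -> #|v'| = k.+1 -> push hi v = push hi v' -> v = v'.
  move=> /hiP[E <-] /hiP[F <-]; rewrite !push_hi => /phi_hi.
  by rewrite !phiK.
have lo_crd (v : {set T}) : #|v| = k -> #|push lo v| = k by move=> /loP[E <-]; rewrite push_lo lo_card.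
have hi_crd (v : {set T}) : #|v| = k.+1 -> #|push hi v| = k.+1.
  by move=> /hiP[E <-]; rewrite push_hi hi_card.
have push_sub (v w : {set T}) : #|v| = k -> #|w| = k.+1 -> v \subset w -> push lo v \subset push hi w.
  by move=> cv cw /(flag cv cw)[E <- <-]; rewrite push_lo push_hi lo_hi.
have [s lo_s] := level_perm k_gt0 k_small lo_crd lo_inj hi_crd hi_inj push_sub.
have hi_s := level_ascend k_gt0 lo_s hi_crd push_sub.
have sE E : lo (phi E) = s @: lo E /\ hi (phi E) = s @: hi E.
  by rewrite -push_lo -push_hi lo_s ?hi_s.
(* If [s (s x)] differs from [x], some k-set contains [x] but not [s (s x)]. It is [lo E] for a flag
   [E], and [phi (phi E) = E] is contradicted. *)
exists s; split=> // x; apply: contraTeq isT => ssxNx.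
have [|A sA cardA] := @subset_of_card T (~: [set x; s (s x)]) k.-1.
  by have := cardsC [set x; s (s x)]; rewrite cards2 eq_sym ssxNx; lia.
have xNA : x \notin A by apply/negP=> /(subsetP sA); rewrite !inE eqxx.
have [|E loE] := loP (x |: A); first by rewrite cardsU1 xNA cardA; lia.
have : s (s x) \in lo (phi (phi E)).
  by rewrite !(sE _).1 !imset_f // loE !inE eqxx.
rewrite phiK loE !inE (negbTE ssxNx) => /(subsetP sA).
by rewrite !inE eqxx orbT.
Qed.

(** A stable set [A] of 2k points leaves out a single point [x], which is fixed. As k is even, [A]
    contains a stable k-set [B], and [B] inside [x |: B] is the flag. *)
Lemma involution_fixes_flag (s : T -> T) : injective s -> involutive s ->
    #|T| = k.*2.+1 -> ~~ odd k ->
  exists E, lo E = s @: lo E /\ hi E = s @: hi E.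
Proof.
move=> s_inj sK cardT k_even.
have stable (A : {set T}) : (forall x, x \in A -> s x \in A) -> A = s @: A.
  move=> stA; apply/eqP; rewrite eq_sym eqEcard card_imset // leqnn andbT.
  by apply/subsetP=> _ /imsetP[x /stA sx ->].
have [|||A [_ cardA stA]] := @involution_stable_subset T s setT k; rewrite ?cardsT ?cardT //.
have [|||B [sBA cardB stB]] := @involution_stable_subset T s A k./2 => //.
  by rewrite cardA; lia.
have kE : k./2.*2 = k by rewrite even_halfK.
have /cards1P[x Ax] : #|~: A| == 1 by have := cardsC A; rewrite cardA cardT; lia.
have xNA : x \notin A by rewrite -in_setC Ax inE.
have sx : s x = x.
  by apply/set1P; rewrite -Ax inE; apply: contra xNA => /stA; rewrite sK.
have xNB : x \notin B by apply: contra xNA; apply/subsetP.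
rewrite kE in cardB.
have [||E loE hiE] := flag cardB (_ : #|x |: B| = k.+1).
- by rewrite cardsU1 xNB cardB.
- exact: subsetUr.
exists E; rewrite loE hiE; split; apply: stable => // y.
by rewrite !inE => /predU1P[->|/stB->]; rewrite ?sx ?eqxx ?orbT.
Qed.

(** The flags above a k-set correspond to its upper covers, so there are C(#|T|, k) (#|T| - k) of
    them. *)
Lemma card_flags : #|V| * (k`! * (#|T| - k.+1)`!) = #|T|`!.
Proof.
have card_fiber (v : {set T}) : #|v| = k -> #|[set E | lo E == v]| = #|T| - k.
  move=> cardv; rewrite -cardv -(card_upper_covers v).
  rewrite -(@card_in_imset _ _ hi) => [|E F]; last first.
    by rewrite !inE => /eqP loE /eqP loF; apply: coords.2; rewrite loE.
  apply: eq_card => w; rewrite upper_coversE cardv.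
  apply/imsetP/andP => [[E]|[svw /eqP cardw]].
    by rewrite inE => /eqP <- ->; rewrite lo_hi hi_card eqxx.
  by have [E loE hiE] := flag cardv cardw svw; exists E; rewrite ?inE ?loE.
have -> : #|V| = 'C(#|T|, k) * (#|T| - k).
  rewrite -card_draws -[LHS]sum1_card (partition_big lo (fun v => #|v| == k)) /=; last first.
    by move=> E _; rewrite lo_card.
  rewrite -sum_nat_const; under [RHS]eq_bigl => v do rewrite inE.
  apply: eq_bigr => v /eqP/card_fiber <-; rewrite -sum1_card.
  by apply: eq_bigl => E; rewrite inE.
rewrite -(@bin_fact #|T| k); last by lia.
have -> : #|T| - k = (#|T| - k.+1).+1 by lia.
by rewrite factS; lia.
Qed.

Lemma flags_not_cayley : #|T| = k.*2.+1 -> ~~ odd k -> (forall t, k != 2 ^ t) ->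
  ~ is_cayley e.
Proof.
move=> cardT k_even kNpow [gT [Om [_ _ [f [f_bij f_e]]]]].
have [f' fK f'K] := f_bij.
(* Left translation by [g], transported to the flags; it leaves the quotients defining adjacency
   unchanged. *)
pose phi (g : gT) E := f' (g * f E)%g.
have phi_e g E F : e (phi g E) (phi g F) = e E F.
  by rewrite /phi !f_e !f'K invMg -mulgA mulKg.
have phiM g h E : phi (g * h)%g E = phi g (phi h E) by rewrite /phi f'K mulgA.
have phi1 E : phi 1%g E = E by rewrite /phi mul1g fK.
have phi_inj g : injective (phi g).
  by move=> E F /(congr1 (phi g^-1%g)); rewrite -!phiM mulVg !phi1.
have phi_free g E : phi g E = E -> g = 1%g.
  move/(congr1 f); rewrite /phi f'K => gE.
  by apply: (mulIg (f E)); rewrite gE mul1g.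
pose keeps (l : V -> {set T}) g :=
  [forall E, forall F, (l E == l F) ==> (l (phi g E) == l (phi g F))].
have keepsP l g : reflect (respects l l (phi g)) (keeps l g).
  apply: (iffP forallP) => [kg E F /eqP EF|kg E].
    by apply/eqP; have /forallP/(_ F)/implyP/(_ EF) := kg E.
  by apply/forallP=> F; apply/implyP=> /eqP/kg/eqP.
pose R := [set g | keeps lo g && keeps hi g].
have RP g : reflect (respects lo lo (phi g) /\ respects hi hi (phi g)) (g \in R).
  by rewrite inE; apply: (iffP andP) => -[/keepsP ? /keepsP ?].
have R_group : group_set R.
  apply/group_setP; split; first by apply/RP; split=> E F; rewrite !phi1.
  move=> g h /RP[glo ghi] /RP[hlo hhi]; apply/RP.
  by split=> E F EF; rewrite !phiM; [apply/glo/hlo|apply/ghi/hhi].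
have notR g : g \notin R -> respects lo hi (phi g) /\ respects hi lo (phi g).
  by move/RP=> gNR; case: (respects_flags (@phi_inj g) (phi_e g)).
have notRM g h : g \notin R -> h \notin R -> (g * h)%g \in R.
  move=> /notR[g1 g2] /notR[h1 h2]; apply/RP.
  by split=> E F EF; rewrite !phiM; [apply/g2/h1|apply/g1/h2].
have card_gT : #|gT| = #|V| by apply/esym/(bij_eq_card f_bij).
(* Comparing valuations in #|V| (k!)^2 = (2k+1)! gives v_2(#|V|) = k - v_2(k!), which is at least
   2. *)
have dvd4 : 4 %| #|gT|.
  have := card_flags; rewrite cardT (_ : k.*2.+1 - k.+1 = k); last by lia.
  have V_gt0 : 0 < #|V| by rewrite -card_gT; apply/card_gt0P; exists 1%g.
  move/(congr1 (logn 2)).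
  rewrite factS !lognM ?muln_gt0 ?fact_gt0 // logn2_fact_double.
  rewrite (lognE 2 k.*2.+1) dvdn2 /= odd_double /= => logV.
  rewrite -[4]/(2 ^ 2) pfactor_dvdn // card_gT //.
  have := logn2_fact_le k_gt0 kNpow; move: logV.
  by move: (logn 2 #|V|) (logn 2 k`!); lia.
(* Either [R] is the whole group, or its complement is a coset [g *: R] and #|gT| is twice #|R|. *)
have dvd2 : 2 %| #|Group R_group|.
  have [g gNR|allR] := pickP [pred g | g \notin R]; last first.
    rewrite (_ : #|_| = #|gT|); first exact: dvdn_trans dvd4.
    by apply: eq_card => g; have := allR g => /= /negbFE ->.
  have gVNR : (g^-1)%g \notin R by rewrite -(groupV (Group R_group)) invgK in gNR *.
  have RC : ~: R = (g *: R)%g.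
    apply/setP=> h; rewrite inE mem_lcoset; apply/idP/idP => [hNR|ghR].
      exact: notRM.
    apply: contra gVNR => hR.
    have hVR : (h^-1)%g \in R by exact: (@groupVr _ (Group R_group)).
    by have := @groupM _ (Group R_group) _ _ ghR hVR; rewrite mulgK.
  have := cardsC R; rewrite RC card_lcoset /= => cardR.
  by move: dvd4; rewrite -cardR addnn -mul2n (@dvdn_pmul2l 2 2).
have [t tR ot] := Cauchy (isT : prime 2) dvd2.
have /RP[t_lo t_hi] : t \in R by [].
have tK : involutive (phi t).
  by move=> E; rewrite -phiM -expg2 -ot expg_order phi1.
have [s [sK sE]] := respects_flags_perm t_lo t_hi tK.
have [E [loE hiE]] := involution_fixes_flag perm_inj sK cardT k_even.
have /phi_free t1 : phi t E = E.
  by apply: coords.2; rewrite ?(sE E).1 ?(sE E).2 -?loE -?hiE.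
by rewrite t1 order1 in ot.
Qed.

End Flags.

(** * Transitivity of permutations on flags *)

(** Each transposition trades a point of [A :\: B] for one of [B :\: A]. The control of the support
    is what [perm_flag_eq] relies on. *)
Lemma perm_imset_eq (T : finType) (A B : {set T}) : #|A| = #|B| ->
  exists2 s : {perm T}, perm_on (A :|: B) s & s @: A = B.
Proof.
have [m] := ubnP #|A :\: B|; elim: m A => // m IHm A lt_m cardAB.
have [sAB|/subsetPn[a Aa BNa]] := boolP (A \subset B).
  have <- : A = B by apply/eqP; rewrite eqEcard sAB cardAB leqnn.
  exists 1%g; first exact: perm_on1.
  by rewrite (eq_imset (g := id)) ?imset_id // => x; rewrite perm1.
have /subsetPn[b Bb ANb] : ~~ (B \subset A).
  apply: contra BNa => sBA; rewrite (_ : B = A) //.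
  by apply/eqP; rewrite eqEcard sBA cardAB leqnn.
have tE : tperm a b @: A = b |: (A :\ a).
  have cardA := cardsD1 a A; rewrite Aa in cardA.
  apply/eqP; rewrite eqEcard card_imset; last exact: perm_inj.
  rewrite cardsU1 !inE (negbTE ANb) andbF /= {1}cardA leqnn andbT.
  apply/subsetP=> _ /imsetP[x Ax ->]; rewrite !inE.
  case: tpermP => [_|xb|/eqP xNa _]; [by rewrite eqxx|by rewrite -xb Ax in ANb|].
  by rewrite xNa Ax orbT.
have [||s s_on sE] := IHm (tperm a b @: A).
- have sub : (tperm a b @: A) :\: B \subset (A :\: B) :\ a.
    apply/subsetP=> x; rewrite tE !inE => /andP[BNx /orP[/eqP xb|/andP[-> ->]]].
      by rewrite xb Bb in BNx.
    by rewrite BNx.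
  have := subset_leq_card sub; have := cardsD1 a (A :\: B).
  by rewrite !inE Aa BNa; lia.
- by rewrite card_imset //; apply: perm_inj.
exists (tperm a b * s)%g; last first.
  by rewrite -[RHS]sE -imset_comp; apply: eq_imset => x; rewrite permM.
apply: perm_onM.
  by apply/subsetP=> x; rewrite !inE; case: tpermP => [->|->|]; rewrite ?Aa ?Bb ?orbT ?eqxx.
apply: subset_trans s_on _; rewrite tE; apply/subsetP=> x; rewrite !inE.
by case/orP=> [/predU1P[->|/andP[_ ->]]|->]; rewrite ?Bb ?orbT.
Qed.

(** First [w] is moved to [w']; the image of [v] is then corrected by a permutation supported in
    [w'], which preserves [w']. *)
Lemma perm_flag_eq (T : finType) (v w v' w' : {set T}) :
    #|v| = #|v'| -> #|w| = #|w'| -> v \subset w -> v' \subset w' ->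
  exists s : {perm T}, s @: v = v' /\ s @: w = w'.
Proof.
move=> cardv /perm_imset_eq[s _ sw] svw svw'.
have svw1 : s @: v \subset w' by rewrite -sw imsetS.
have [|t t_on tv] := @perm_imset_eq T (s @: v) v'.
  by rewrite card_imset //; apply: perm_inj.
have tw : perm_on w' t.
  by apply: subset_trans t_on _; rewrite subUset svw1.
exists (s * t)%g; split.
  by rewrite -tv -imset_comp; apply: eq_imset => x; rewrite permM.
rewrite -[RHS](im_perm_on tw) -sw -imset_comp.
by apply: eq_imset => x; rewrite permM.
Qed.

Lemma flags_vertex_transitive (T V : finType) (e : rel V) (lo hi : V -> {set T}) k :
    (forall E, #|lo E| = k) -> (forall E, #|hi E| = k.+1) ->
    (forall E, lo E \subset hi E) ->
    (forall v w : {set T}, #|v| = k -> #|w| = k.+1 -> v \subset w ->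
      exists2 E, lo E = v & hi E = w) ->
    line_coords e lo hi ->
  vertex_transitive e.
Proof.
move=> lo_card hi_card lo_hi flag [adj inj] E F.
have [||||s [slo shi]] := @perm_flag_eq T (lo E) (hi E) (lo F) (hi F);
  rewrite ?lo_card ?hi_card //.
have s_inj : injective (fun A : {set T} => s @: A) by apply/imset_inj/perm_inj.
have /fin_all_exists[phi phiE] G : exists H, lo H = s @: lo G /\ hi H = s @: hi G.
  have [|||H loH hiH] := flag (s @: lo G) (s @: hi G);
    rewrite ?(card_imset _ perm_inj) ?imsetS //.
  by exists H.
have phi_inj : injective phi.
  move=> G H eq_phi; apply: inj; apply: s_inj => /=.
    by rewrite -!(phiE _).1 eq_phi.
  by rewrite -!(phiE _).2 eq_phi.
exists phi; split; last by apply: inj; rewrite ?(phiE E).1 ?(phiE E).2.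
split=> [|G H]; first exact: injF_bij.
by rewrite !adj (inj_eq phi_inj) !(phiE _).1 !(phiE _).2 !(inj_eq s_inj).
Qed.

(** * Edges as flags *)

Section LineGraph.
Variables n k : nat.
Local Notation vert := (Bvert n k).
Local Notation lvert := (line_vert (@Badj n k)).
Implicit Types (E F : lvert) (u w : vert).

(** The ends of an edge are nested, so intersection and union recover the smaller and the larger one
    without ordering the pair. *)
Definition edge_lo E : {set 'I_n} := \bigcap_(u in val E) val u.
Definition edge_hi E : {set 'I_n} := \bigcup_(u in val E) val u.

Lemma Bvert_edge E : exists u w, val E = [set u; w] /\
  [/\ val u \subset val w, #|val u| = k, #|val w| = k.+1,
      edge_lo E = val u & edge_hi E = val w].
Proof.
have ordered u w : val u \proper val w -> val E = [set u; w] ->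
  exists u w, val E = [set u; w] /\
  [/\ val u \subset val w, #|val u| = k, #|val w| = k.+1,
      edge_lo E = val u & edge_hi E = val w].
  move=> uw DE; exists u, w; split=> //.
  have suw := proper_sub uw; have lt_uw := proper_card uw.
  have uNw : u \notin [set w] by rewrite inE; apply: contraTneq uw => ->; rewrite properxx.
  rewrite /edge_lo /edge_hi DE !big_setU1 // !big_set1 /= (setIidPl suw) (setUidPr suw).
  have := valP u; have := valP w.
  by move=> /orP[]/eqP cw /orP[]/eqP cu; split=> //; lia.
have := valP E; rewrite inE => /existsP[u /existsP[w /andP[/orP[]uw /eqP DE]]].
  exact: ordered uw DE.
by apply: ordered uw _; rewrite setUC.
Qed.

Lemma edge_lo_card E : #|edge_lo E| = k.
Proof. by have [u [w [_ [_ cu _ -> _]]]] := Bvert_edge E. Qed.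

Lemma edge_hi_card E : #|edge_hi E| = k.+1.
Proof. by have [u [w [_ [_ _ cw _ ->]]]] := Bvert_edge E. Qed.

Lemma edge_lo_hi E : edge_lo E \subset edge_hi E.
Proof. by have [u [w [_ [suw _ _ -> ->]]]] := Bvert_edge E. Qed.

Lemma edge_of_flag (v w : {set 'I_n}) : #|v| = k -> #|w| = k.+1 -> v \subset w ->
  exists2 E, edge_lo E = v & edge_hi E = w.
Proof.
move=> cv cw svw.
have vP : (#|v| == k) || (#|v| == k.+1) by rewrite cv eqxx.
have wP : (#|w| == k) || (#|w| == k.+1) by rewrite cw eqxx orbT.
pose v' : vert := exist _ v vP; pose w' : vert := exist _ w wP.
have vw : v \proper w by rewrite properEcard svw cv cw /=.
have EP : [set v'; w'] \in edge_set (@Badj n k).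
  rewrite inE; apply/existsP; exists v'; apply/existsP; exists w'.
  by rewrite eqxx andbT /Badj /= vw.
have vNw : v' \notin [set w'].
  by rewrite inE -val_eqE /=; apply: contraTneq vw => ->; rewrite properxx.
exists (exist _ [set v'; w'] EP : lvert); rewrite /edge_lo /edge_hi /= big_setU1 // big_set1 /=.
  exact/setIidPl.
exact/setUidPr.
Qed.

Lemma edge_coords : line_coords (@line_adj vert (@Badj n k)) edge_lo edge_hi.
Proof.
split=> E F; last first.
  have [u [w [DE [_ _ _ -> ->]]]] := Bvert_edge E.
  have [u' [w' [DF [_ _ _ -> ->]]]] := Bvert_edge F.
  by move=> /val_inj uu /val_inj ww; apply: val_inj; rewrite DE DF uu ww.
rewrite /line_adj val_eqE; congr (_ && _).
have [u [w [DE [_ cu cw -> ->]]]] := Bvert_edge E.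
have [u' [w' [DF [_ cu' cw' -> ->]]]] := Bvert_edge F.
rewrite DE DF; apply/set0Pn/orP=> [[x]|[]/eqP/val_inj->].
(* A common end is the smaller one of both edges or the larger one of both, as the sizes k and k+1
   differ. *)
- rewrite !inE => /andP[/orP[]/eqP-> /orP[]/eqP eq_uw]; rewrite eq_uw ?eqxx; auto.
    by move: cu; rewrite eq_uw cw'; lia.
  by move: cw; rewrite eq_uw cu'; lia.
- by exists u'; rewrite !inE eqxx.
- by exists w'; rewrite !inE eqxx !orbT.
Qed.

End LineGraph.

Theorem theorem3p22 (k : nat) :
  2 < k -> ~~ odd k -> (forall t : nat, 2 <= t -> k != 2 ^ t) ->
  vertex_transitive (@line_adj (Bvert (2 * k + 1) k) (@Badj (2 * k + 1) k)) /\
  ~ is_cayley (@line_adj (Bvert (2 * k + 1) k) (@Badj (2 * k + 1) k)).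
Proof.
move=> k_gt2 k_even kNpow; split.
  exact: (flags_vertex_transitive (@edge_lo_card _ _) (@edge_hi_card _ _)
           (@edge_lo_hi _ _) (@edge_of_flag _ _) (@edge_coords _ _)).
have cardT : #|'I_(2 * k + 1)| = k.*2.+1 by rewrite card_ord; lia.
have kNpow' t : k != 2 ^ t.
  by case: t => [|[|t]]; [lia|lia|exact: kNpow].
apply: (flags_not_cayley _ _ (@edge_lo_card _ _) (@edge_hi_card _ _)
         (@edge_lo_hi _ _) (@edge_of_flag _ _) (@edge_coords _ _) cardT k_even kNpow').
  by lia.
by rewrite cardT; lia.
Qed.
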